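(* Let $K(x)=\frac{\omega(x)}{|x|^n}$, $x\in\mathbb{R}^n\setminus\{0\}$, where $\omega$ is an even homogeneous function of degree $0$, integrable on the unit sphere and with vanishing integral there. Let $T$ be the associated Calderón-Zygmund operator $T(f)(x)=\mathrm{PV}\int f(x-y)\,K(y)\,dy$. Then $$T(\chi_B)\,\chi_B=0\quad\text{for each ball } B\subset\mathbb{R}^n.$$
   Context: Even means $\omega(-x)=\omega(x)$ for $x\ne0$. Balls are open. The principal value is $T(f)(x)=\lim_{\delta\to0}\int_{|x-y|>\delta}f(y)K(x-y)\,dy$. No smoothness of $\omega$ is assumed. *)

(* Defs.v *)
From HB Require Import structures.
From mathcomp Require Import all_boot all_order all_algebra.
From mathcomp Require Import complex.
From mathcomp Require Import all_classical all_reals all_analysis.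
From mathcomp Require Import measurable_realfun.

Set Implicit Arguments.
Unset Strict Implicit.
Unset Printing Implicit Defensive.
Import Order.TTheory GRing.Theory Num.Theory.
Import numFieldNormedType.Exports.

Local Open Scope classical_set_scope.
Local Open Scope ring_scope.

(* The usual topology of the complex numbers, given by the modulus. *)
HB.instance Definition _ (R : realType) := NormedModule.copy R[i] R[i]^o.

(* The Borel sigma-algebra on 'rV_n. The norm and the balls already available
   on 'rV_n are those of the sup norm: distances and balls below are written
   with the Euclidean norm enorm instead. *)
Definition rV_display : measure_display. Proof. exact: default_measure_display. Qed.

Section borel_rV.
Variables (R : realType) (n : nat).

Definition rV_coord (i : 'I_n) (x : 'rV[R]_n) : measurableTypeR R := x ord0 i.

Let rV_set0 : g_sigma_preimage rV_coord set0.
Proof. exact: sigma_algebra0. Qed.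

Let rV_setC A : g_sigma_preimage rV_coord A -> g_sigma_preimage rV_coord (~` A).
Proof. exact: sigma_algebraC. Qed.

Let rV_bigcup (F : (set 'rV[R]_n)^nat) :
  (forall i, g_sigma_preimage rV_coord (F i)) ->
  g_sigma_preimage rV_coord (\bigcup_i F i).
Proof. exact: sigma_algebra_bigcup. Qed.

HB.instance Definition _ := @isMeasurable.Build rV_display 'rV[R]_n
  (g_sigma_preimage rV_coord) rV_set0 rV_setC rV_bigcup.

Lemma measurable_rV_coord (i : 'I_n) :
  measurable_fun [set: 'rV[R]_n] (rV_coord i).
Proof.
move=> _ Y mY; rewrite setTI; apply: sub_sigma_algebra => /=.
rewrite -bigcup_seq/=; exists i => /=; first by rewrite mem_index_enum.
by exists Y => //; rewrite setTI.
Qed.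

Lemma measurable_fun_rV d (T : measurableType d) (f : T -> 'rV[R]_n) :
  (forall i, measurable_fun [set: T] (rV_coord i \o f)) ->
  measurable_fun [set: T] f.
Proof.
move=> mf; apply: (@measurability _ _ _ _ setT f
  (\big[setU/set0]_(i < n) preimage_set_system setT (rV_coord i) measurable)).
  by [].
move=> _ [B + <-]; rewrite -bigcup_seq/= => -[i _ [Y mY <-]].
rewrite !setTI -comp_preimage.
by rewrite -[X in measurable X]setTI; exact: mf.
Qed.

End borel_rV.

Section lebesgue_rV.
Variable R : realType.

Definition rV_cons m (p : measurableTypeR R * 'rV[R]_m) : 'rV[R]_m.+1 :=
  \row_i (if unlift ord0 i is Some j then p.2 ord0 j else p.1).

Definition rV_uncons m (x : 'rV[R]_m.+1) : measurableTypeR R * 'rV[R]_m :=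
  (x ord0 ord0, \row_j x ord0 (lift ord0 j)).

Lemma rV_cons0 m (p : measurableTypeR R * 'rV[R]_m) : rV_cons p ord0 ord0 = p.1.
Proof. by rewrite mxE unlift_none. Qed.

Lemma rV_consS m (p : measurableTypeR R * 'rV[R]_m) j :
  rV_cons p ord0 (lift ord0 j) = p.2 ord0 j.
Proof. by rewrite mxE liftK. Qed.

Lemma rV_consK m : cancel (@rV_cons m) (@rV_uncons m).
Proof.
move=> [a v]; rewrite /rV_uncons rV_cons0; congr pair.
by apply/rowP => j; rewrite mxE rV_consS.
Qed.

Lemma rV_unconsK m : cancel (@rV_uncons m) (@rV_cons m).
Proof.
move=> x; apply/rowP => i.
case: (unliftP ord0 i) => [j|] ->; last by rewrite rV_cons0.
by rewrite rV_consS mxE.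
Qed.

Lemma measurable_rV_cons m : measurable_fun setT (@rV_cons m).
Proof.
apply: measurable_fun_rV => i.
case: (unliftP ord0 i) => [j|] ->.
  rewrite (_ : _ \o _ = rV_coord j \o snd); last first.
    by apply/funext => p /=; rewrite /rV_coord rV_consS.
  by apply: measurableT_comp => //; exact: measurable_rV_coord.
rewrite (_ : _ \o _ = fst)//.
by apply/funext => p /=; rewrite /rV_coord rV_cons0.
Qed.

Lemma measurable_rV_uncons m : measurable_fun setT (@rV_uncons m).
Proof.
apply: measurable_fun_pair; first exact: (@measurable_rV_coord R m.+1 ord0).
apply: measurable_fun_rV => j.
rewrite (_ : _ \o _ = rV_coord (lift ord0 j)); first exact: measurable_rV_coord.
by apply/funext => x /=; rewrite /rV_coord mxE.
Qed.

Section rV_cons_measure.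
Variables (m : nat) (mu : {sigma_finite_measure set 'rV[R]_m -> \bar R}).

Definition rV_cons_measure : set 'rV[R]_m.+1 -> \bar R :=
  pushforward (lebesgue_measure \x mu)%E (@rV_cons m).

Let mcons (A : set 'rV[R]_m.+1) :
  measurable A -> measurable (@rV_cons m @^-1` A).
Proof.
by move=> mA; rewrite -[X in measurable X]setTI; exact: measurable_rV_cons.
Qed.

Let rV_cons_measure0 : rV_cons_measure set0 = 0%E.
Proof. by rewrite /rV_cons_measure /pushforward preimage_set0 measure0. Qed.

Let rV_cons_measure_ge0 A : (0 <= rV_cons_measure A)%E.
Proof. by rewrite /rV_cons_measure /pushforward; exact: measure_ge0. Qed.

Let rV_cons_measure_sigma_additive : semi_sigma_additive rV_cons_measure.
Proof.
move=> F mF tF mUF; rewrite /rV_cons_measure /pushforward preimage_bigcup.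
apply: measure_semi_sigma_additive.
- by move=> k; exact: mcons.
- apply/trivIsetP => i j _ _ ij; rewrite -preimage_setI.
  by move/trivIsetP : tF => /(_ _ _ _ _ ij) ->//; rewrite preimage_set0.
- by rewrite -preimage_bigcup; exact: mcons.
Qed.

HB.instance Definition _ := isMeasure.Build _ _ _ rV_cons_measure
  rV_cons_measure0 rV_cons_measure_ge0 rV_cons_measure_sigma_additive.

Let sigma_finite_rV_cons_measure : sigma_finite setT rV_cons_measure.
Proof.
have /sigma_finiteP[F [TF ndF Foo]] := sigma_finiteT (@lebesgue_measure R).
have /sigma_finiteP[G [TG ndG Goo]] := sigma_finiteT mu.
exists (fun k => @rV_uncons m @^-1` (F k `*` G k)).
  rewrite -preimage_bigcup (_ : \bigcup_k _ = setT) ?preimage_setT//.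
  apply/seteqP; split=> // -[x y] _.
  have [i _ Fix] : (\bigcup_k F k) x by rewrite -TF.
  have [j _ Gjy] : (\bigcup_k G k) y by rewrite -TG.
  exists (maxn i j) => //; split => /=.
    by move: x Fix; apply/subsetPset/ndF/leq_maxl.
  by move: y Gjy; apply/subsetPset/ndG/leq_maxr.
move=> k; have [mF Fk] := Foo k; have [mG Gk] := Goo k; split.
  rewrite -[X in measurable X]setTI; apply: measurable_rV_uncons => //.
  exact: measurableX.
rewrite /rV_cons_measure /pushforward -comp_preimage.
rewrite (_ : _ \o _ = idfun) ?preimage_id; last exact/funext/rV_consK.
by rewrite product_measure1E// lte_mul_pinfty// ge0_fin_numE.
Qed.

HB.instance Definition _ := Measure_isSigmaFinite.Build _ _ _ rV_cons_measure
  sigma_finite_rV_cons_measure.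

End rV_cons_measure.

Fixpoint borel_lebesgue (n : nat) :
    {sigma_finite_measure set 'rV[R]_n -> \bar R} :=
  match n with
  | 0 => \d_(0 : 'rV[R]_0)
  | m.+1 => rV_cons_measure (borel_lebesgue m)
  end.

End lebesgue_rV.

Lemma borel_lebesgue_box (R : realType) (n : nat) (a b : 'rV[R]_n) :
  (forall i, a ord0 i <= b ord0 i) ->
  borel_lebesgue R n
    [set x : 'rV[R]_n | forall i, `]a ord0 i, b ord0 i]%classic (x ord0 i)] =
  (\prod_(i < n) (b ord0 i - a ord0 i))%:E.
Proof.
elim: n a b => [|m IH] a b ab /=.
  by rewrite big_ord0 diracE mem_set//= => -[].
rewrite /rV_cons_measure /pushforward.
rewrite (_ : _ @^-1` _ = `]a ord0 ord0, b ord0 ord0]%classic `*`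
    [set x : 'rV[R]_m | forall i,
      `](rV_uncons a).2 ord0 i, (rV_uncons b).2 ord0 i]%classic (x ord0 i)]);
    last first.
  apply/seteqP; split=> [[u v]/= H|[u v]/= [H0 H] i].
    split; first by have := H ord0; rewrite rV_cons0.
    by move=> i; have := H (lift ord0 i); rewrite rV_consS !mxE.
  case: (unliftP ord0 i) => [j|] ->; last by rewrite rV_cons0.
  by have := H j; rewrite rV_consS !mxE.
rewrite product_measure1E//; last first.
  rewrite (_ : [set x | _] = \bigcap_(i in [set: 'I_m])
     ((@rV_coord R m i) @^-1` 
       `](rV_uncons a).2 ord0 i, (rV_uncons b).2 ord0 i]%classic)).
    apply: fin_bigcap_measurable => // i _.
    by rewrite -[X in measurable X]setTI; exact: measurable_rV_coord.
  by apply/seteqP; split=> x /= H i; [move=> _|]; apply: H.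
rewrite IH; last by move=> i; rewrite !mxE.
rewrite big_ord_recl EFinM; congr (_ * _)%E; last first.
  by congr EFin; apply: eq_bigr => i _; rewrite !mxE.
apply: (etrans (lebesgue_measure_itv `]a ord0 ord0, b ord0 ord0])); rewrite /= lte_fin.
case: ltP => // ba; have -> : b ord0 ord0 = a ord0 ord0.
  by apply/le_anti; rewrite ba ab.
by rewrite subrr.
Qed.

(* The carrier of R^n with the sigma-algebra of all Lebesgue measurable sets
   (the Caratheodory sets of borel_lebesgue), so that measurability and
   integrability below are in the sense of Lebesgue, not of Borel. *)

Definition lebesgue_space (R : realType) (n : nat) :=
  caratheodory_type ((borel_lebesgue R n)^*)%mu.

Definition lebesgue_rV (R : realType) (n : nat) :
    set (lebesgue_space R n) -> \bar R :=
  @completed_measure_extension _ _ _ (borel_lebesgue R n).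

HB.instance Definition _ (R : realType) (n : nat) :=
  Measure.on (@lebesgue_rV R n).

Section euclidean.
Variables (R : realType) (n : nat).
Implicit Types x y c : 'rV[R]_n.

Definition enorm x : R := Num.sqrt (\sum_(i < n) x ord0 i ^+ 2).

Definition eball c (r : R) : set 'rV[R]_n := [set y | enorm (y - c) < r].

Definition unit_sphere : set 'rV[R]_n := [set x | enorm x = 1].

Definition radial x : 'rV[R]_n := (enorm x)^-1 *: x.

Definition punctured_ball : set 'rV[R]_n := [set x | 0 < enorm x < 1].

Lemma measurable_enorm :
  measurable_fun [set: 'rV[R]_n] enorm.
Proof.
apply: (measurableT_comp (f := @Num.sqrt R)).
  by apply: continuous_measurable_fun; exact: sqrt_continuous.
apply: measurable_sum => i.
apply: measurable_funX.
exact: measurable_rV_coord.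
Qed.

Lemma measurable_punctured_ball :
  measurable (punctured_ball : set (lebesgue_space R n)).
Proof.
apply: caratheodory_measurable_mu_ext.
rewrite (_ : punctured_ball = enorm @^-1` `]0, 1[%classic); last first.
  by apply/seteqP; split=> x /=; rewrite in_itv.
rewrite -[X in measurable X]setTI; exact: measurable_enorm.
Qed.

End euclidean.

(* Surface measure on the unit sphere, carried by 'rV_n: a set A of directions is
   measurable when the cone {x | x / |x| in A} is Lebesgue measurable, and its
   measure is n times the volume of the part of that cone in the punctured unit
   ball. This is the normalisation for which dx = rho^(n-1) drho dsigma. *)

Definition sphere_space (R : realType) (n : nat) := 'rV[R]_n.

Definition sphere_display : measure_display -> measure_display.
Proof. exact. Qed.

Section surface_measure.
Variables (R : realType) (n : nat).

Let dir : lebesgue_space R n -> sphere_space R n := @radial R n.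

Definition sphere_measurable : set (set (sphere_space R n)) :=
  image_set_system setT dir measurable.

Let sigma_algebra_sphere : sigma_algebra setT sphere_measurable.
Proof. exact/sigma_algebra_image/sigma_algebra_measurable. Qed.

Let sphere_set0 : sphere_measurable set0.
Proof. by case: sigma_algebra_sphere. Qed.

Let sphere_setC A : sphere_measurable A -> sphere_measurable (~` A).
Proof. by rewrite -setTD; case: sigma_algebra_sphere => _ + _; exact. Qed.

Let sphere_bigcup (F : (set (sphere_space R n))^nat) :
  (forall i, sphere_measurable (F i)) -> sphere_measurable (\bigcup_i F i).
Proof. by case: sigma_algebra_sphere => _ _; exact. Qed.

HB.instance Definition _ := Pointed.on (sphere_space R n).
HB.instance Definition _ := @isMeasurable.Build (sphere_display rV_display)
  (sphere_space R n) sphere_measurable sphere_set0 sphere_setC sphere_bigcup.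

Definition surface_measure (A : set (sphere_space R n)) : \bar R :=
  (n%:R%:E * lebesgue_rV (dir @^-1` A `&` @punctured_ball R n))%E.

Let msphere (A : set (sphere_space R n)) :
  measurable A -> measurable (dir @^-1` A `&` @punctured_ball R n).
Proof.
move=> mA; apply: measurableI; last exact: measurable_punctured_ball.
by rewrite -[X in measurable X]setTI.
Qed.

Let surface_measure0 : surface_measure set0 = 0%E.
Proof. by rewrite /surface_measure preimage_set0 set0I measure0 mule0. Qed.

Let surface_measure_ge0 A : (0 <= surface_measure A)%E.
Proof. by rewrite /surface_measure mule_ge0// lee_fin. Qed.

Let surface_measure_sigma_additive : semi_sigma_additive surface_measure.
Proof.
move=> F mF tF mUF; rewrite /surface_measure.
rewrite [X in X @ _ --> _](_ : _ = (fun k => n%:R%:E *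
    \sum_(0 <= i < k) lebesgue_rV (dir @^-1` F i `&` @punctured_ball R n)))%E;
  last by apply/funext => k; rewrite ge0_sume_distrr.
apply: cvgeZl => //; rewrite preimage_bigcup setI_bigcupl.
apply: measure_semi_sigma_additive.
- by move=> k; exact: msphere.
- apply/trivIsetP => i j _ _ ij; rewrite setIACA -preimage_setI.
  by move/trivIsetP : tF => /(_ _ _ _ _ ij) ->//; rewrite preimage_set0 set0I.
- by rewrite -setI_bigcupl -preimage_bigcup; exact: msphere.
Qed.

HB.instance Definition _ := isMeasure.Build _ _ _ surface_measure
  surface_measure0 surface_measure_ge0 surface_measure_sigma_additive.

End surface_measure.

Section complex_integral.
Context d (T : measurableType d) (R : realType).
Variables (mu : {measure set T -> \bar R}) (D : set T) (f : T -> R[i]).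

Definition cintegrable : Prop :=
  mu.-integrable D (fun x => (complex.Re (f x))%:E) /\
  mu.-integrable D (fun x => (complex.Im (f x))%:E).

Definition cintegral : R[i] :=
  Complex (\int[mu]_(x in D) complex.Re (f x))
          (\int[mu]_(x in D) complex.Im (f x)).

End complex_integral.

(* cz_operator K f x is the principal value of the integral of f(y) K(x - y) over
   |x - y| > delta as delta tends to 0+. As lim is total, cz_defined records that
   the truncated integrals converge absolutely and have a limit. *)
Section calderon_zygmund.
Variables (R : realType) (n : nat).
Implicit Types (omega K f : 'rV[R]_n -> R[i]) (x : 'rV[R]_n).

Definition cz_kernel omega x : R[i] :=
  omega x / (real_complex R (enorm x ^+ n)).

Definition cz_domain x (delta : R) : set (lebesgue_space R n) :=
  [set y : 'rV[R]_n | delta < enorm (x - y)].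

Definition cz_integrand K f x : lebesgue_space R n -> R[i] :=
  fun y : 'rV[R]_n => f y * K (x - y).

Definition cz_truncated K f x (delta : R) : R[i] :=
  cintegral (@lebesgue_rV R n) (cz_domain x delta) (cz_integrand K f x).

Definition cz_defined K f x : Prop :=
  (forall delta : R, 0 < delta ->
    cintegrable (@lebesgue_rV R n) (cz_domain x delta) (cz_integrand K f x)) /\
  cvg (cz_truncated K f x @ 0^'+).

Definition cz_operator K f x : R[i] := lim (cz_truncated K f x @ 0^'+).

End calderon_zygmund.

(* Main.v *)
(** Let x be in B, a = x - c, and substitute y = x - z.  In polar coordinates
   z = s th, the direction th contributes omega(th) times the integral of ds/s
   over delta < s < rho(th), where rho(th) is the distance from x to the sphere
   bounding B in the direction - th.  By the power of the point x,
   rho(th) rho(- th) = r^2 - |a|^2 does not depend on th; as omega is even,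
   averaging over th and - th turns ln (rho(th) / delta) into a constant, and
   the integral vanishes since omega has mean zero.  So the truncated integrals
   are exactly 0 for small delta.  The argument is run on the positive and
   negative parts of omega, where Tonelli's theorem applies. *)

Require Import Defs.
From HB Require Import structures.
From mathcomp Require Import all_boot all_order all_algebra.
From mathcomp Require Import complex.
From mathcomp Require Import all_classical all_reals all_analysis.
From mathcomp Require Import measurable_realfun.
From mathcomp Require Import ring lra.

Set Implicit Arguments.
Unset Strict Implicit.
Unset Printing Implicit Defensive.
Import Order.TTheory GRing.Theory Num.Theory.
Import numFieldNormedType.Exports.

Local Open Scope classical_set_scope.
Local Open Scope ring_scope.

(** * Image measures and measurability of preimages and inverses *)

Section image_measure.
Context d d' (T1 : measurableType d) (T2 : measurableType d') (R : realType).

(* The measure structure of [pushforward] hides the measurability proof, which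
   unification cannot recover; here it is an explicit argument. *)
Definition image_measure (m : {measure set T1 -> \bar R}) (f : T1 -> T2)
    (mf : measurable_fun setT f) : {measure set T2 -> \bar R} :=
  measure_function_pushforward__canonical__measure_function_Measure m mf.

End image_measure.

Lemma measurable_preimage d d' (T1 : measurableType d) (T2 : measurableType d')
    (f : T1 -> T2) (A : set T2) :
  measurable_fun setT f -> measurable A -> measurable (f @^-1` A).
Proof. by move=> mf mA; rewrite -[X in measurable X]setTI; exact: mf. Qed.

(** The real power of exponent -1 is measurable on the whole line and agrees with the inverse on
    nonnegative arguments, 0 included. *)
Lemma measurable_funV_ge0 d (T : measurableType d) (R : realType) (f : T -> R) :
  (forall x, 0 <= f x) -> measurable_fun setT f ->
  measurable_fun setT (fun x => (f x)^-1).
Proof.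
move=> f0 mf; rewrite (_ : (fun x => _) = (fun x => f x `^ -1)).
  exact: (measurableT_comp (measurable_powR _)).
by apply/funext => x; rewrite powR_inv1.
Qed.

(** * Lebesgue measure under affine maps: on the line, on Borel sets, on the completion *)

Section lebesgue_affine.
Variable R : realType.
Implicit Types s : R.

Lemma measurable_affine1 s (v : R) :
  measurable_fun setT (fun x : measurableTypeR R => s * x + v : measurableTypeR R).
Proof. by apply: measurable_funD => //; exact: measurable_funM. Qed.

(** By uniqueness of Lebesgue measure, half-open intervals suffice. The sign of [s] matters because
    a negative factor moves the closed endpoint to the left. *)
Lemma lebesgue_measure_affine s (v : R) (A : set (measurableTypeR R)) :
  s != 0 -> measurable A ->
  lebesgue_measure A = (`|s|%:E * lebesgue_measure
    ((fun x : measurableTypeR R => (s * x + v)%R : measurableTypeR R) @^-1` A))%E.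
Proof.
move=> s0 mA.
pose mu : {measure set _ -> \bar R} := mscale (NngNum (normr_ge0 s))
  (image_measure (@lebesgue_measure R) (@measurable_affine1 s v)).
apply: (@lebesgue_measure_unique R mu) => // X [[a b]/= ab <-].
rewrite /mu/= /mscale/= /pushforward.
have itvE (i : interval R) (Y : set (measurableTypeR R)) : Y = [set` i] ->
  lebesgue_measure Y =
  (if i.1 < i.2 then (i.2 : \bar R) - i.1 else 0)%E.
  by move=> ->; exact: lebesgue_measure_itv.
rewrite (itvE `]a, b])//=.
case: (ltP s 0) => [sn|sp].
- rewrite (itvE `[(b - v) / s, (a - v) / s[); last first.
    apply/seteqP; split => x /=; rewrite !in_itv/= ler_ndivrMr// ltr_ndivlMr//;
      by rewrite ltrBlDr lerBrDr [x * s]mulrC andbC.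
  rewrite /= !lte_fin ltr_nM2r ?invr_lt0// ltrD2r.
  case: ifP => _; last by rewrite mule0.
  by rewrite -!EFinB -EFinM ltr0_norm//; congr EFin; field.
- have {}sp : 0 < s by rewrite lt_neqAle eq_sym s0.
  rewrite (itvE `](a - v) / s, (b - v) / s]); last first.
    apply/seteqP; split => x /=; rewrite !in_itv/= ler_pdivlMr// ltr_pdivrMr//;
      by rewrite ltrBlDr lerBrDr [x * s]mulrC.
  rewrite /= !lte_fin ltr_pM2r ?invr_gt0// ltrD2r.
  case: ifP => _; last by rewrite mule0.
  by rewrite -!EFinB -EFinM gtr0_norm//; congr EFin; field.
Qed.

End lebesgue_affine.

Section borel_affine.
Variables (R : realType).

Definition affine n s (v : 'rV[R]_n) (x : 'rV[R]_n) : 'rV[R]_n := s *: x + v.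

Lemma affineK n s (v : 'rV[R]_n) :
  s != 0 -> cancel (affine s v) (affine s^-1 (- (s^-1 *: v))).
Proof.
by move=> s0 x; rewrite /affine scalerDr scalerA mulVf// scale1r addrK.
Qed.

Lemma affineVK n s (v : 'rV[R]_n) :
  s != 0 -> cancel (affine s^-1 (- (s^-1 *: v))) (affine s v).
Proof.
by move=> s0 x; rewrite /affine scalerBr !scalerA mulfV// !scale1r subrK.
Qed.

Lemma measurable_affine n s (v : 'rV[R]_n) : measurable_fun setT (affine s v).
Proof.
apply: measurable_fun_rV => i.
rewrite (_ : _ \o _ = (fun x => s * x + v ord0 i) \o (@rV_coord R n i)).
  by apply: measurableT_comp; [exact: measurable_affine1|exact: measurable_rV_coord].
by apply/funext => x; rewrite /= /rV_coord /affine !mxE.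
Qed.

(** Induction on the dimension: the affine map acts separately on the first coordinate and on the
    rest, so both sides agree on rectangles and uniqueness of the product measure concludes. *)
Lemma borel_lebesgue_affine n s (v : 'rV[R]_n) (A : set 'rV[R]_n) :
  s != 0 -> measurable A ->
  borel_lebesgue R n A =
  ((`|s| ^+ n)%:E * borel_lebesgue R n (affine s v @^-1` A))%E.
Proof.
move=> s0; elim: n v A => [|m IH] v A mA.
  rewrite expr0 mul1e/= !diracE; congr ((_ : bool)%:R%:E).
  apply/idP/idP; rewrite !inE/=;
    by rewrite (_ : affine _ _ _ = 0)//; apply/rowP => -[].
rewrite /= /rV_cons_measure /pushforward.
set v' := (rV_uncons v).2; set v0 := v ord0 ord0.
pose F (p : measurableTypeR R * 'rV[R]_m) : measurableTypeR R * 'rV[R]_m :=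
  ((s * p.1 + v0)%R, affine s v' p.2).
have mF : measurable_fun setT F.
  apply: measurable_fun_pair => /=.
    by apply: (measurableT_comp (@measurable_affine1 R s v0)).
  by apply: (measurableT_comp (@measurable_affine m s v')).
have s0' : 0 <= `|s| ^+ m.+1 by rewrite exprn_ge0.
pose mu : {measure set _ -> \bar R} := mscale (NngNum s0')
  (image_measure (lebesgue_measure \x borel_lebesgue R m)%E mF).
rewrite (@product_measure_unique _ _ _ _ _ lebesgue_measure
    (borel_lebesgue R m) mu)/=; last first.
- by rewrite -[X in measurable X]setTI; exact: measurable_rV_cons.
- move=> B C mB mC; rewrite /mu/= /mscale/= /pushforward.
  have -> : F @^-1` (B `*` C) =
      ((fun x : measurableTypeR R => (s * x + v0)%R : measurableTypeR R) @^-1` B) `*`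
      (affine s v' @^-1` C) by [].
  rewrite product_measure1E//; last 2 first.
  - by rewrite -[X in measurable X]setTI; exact: measurable_affine1.
  - by rewrite -[X in measurable X]setTI; exact: measurable_affine.
  rewrite (IH v' C)// (@lebesgue_measure_affine R s v0 B)//.
  by rewrite exprS EFinM muleACA.
have consF p : rV_cons (F p) = affine s v (rV_cons p).
  apply/rowP => i; case: (unliftP ord0 i) => [j|] ->.
    by rewrite rV_consS !mxE liftK.
  by rewrite rV_cons0 !mxE unlift_none.
have -> : @rV_cons R m @^-1` (affine s v @^-1` A) = F @^-1` (@rV_cons R m @^-1` A).
  by apply/funext => p; rewrite /preimage/= consF.
by [].
Qed.

End borel_affine.

Section lebesgue_affine_completion.
Variables (R : realType) (n : nat).
Implicit Types (s : R) (v : 'rV[R]_n).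

Let mu_star : set 'rV[R]_n -> \bar R := ((borel_lebesgue R n)^*)%mu.

(** The images [G] of a Borel cover [F] of the preimage cover [A], and the Borel case scales every
    term of the sum. *)
Let mu_star_affine_le s v (A : set 'rV[R]_n) : s != 0 ->
  (mu_star A <= (`|s| ^+ n)%:E * mu_star (affine s v @^-1` A))%E.
Proof.
move=> s0; have sn0 : 0 < `|s| ^+ n by rewrite exprn_gt0// normr_gt0.
rewrite -lee_pdivrMl//; apply: le_ereal_inf_tmp => _ [F [mF AF] <-].
pose G i := affine s^-1 (- (s^-1 *: v)) @^-1` F i.
have mG i : measurable (G i).
  by apply: measurable_preimage => //; exact: measurable_affine.
have FE i : F i = affine s v @^-1` G i.
  by apply/funext => x; rewrite /G /preimage/= affineK.
have AG : A `<=` \bigcup_i G i.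
  move=> x Ax; have [|i _ Fi] := AF (affine s^-1 (- (s^-1 *: v)) x).
    by rewrite /preimage/= affineVK.
  by exists i.
have -> : (\sum_(0 <= i <oo) borel_lebesgue R n (F i) =
    (`|s| ^+ n)^-1%:E * \sum_(0 <= i <oo) borel_lebesgue R n (G i))%E.
  rewrite -nneseriesZl//; apply: eq_eseriesr => i _.
  rewrite (borel_lebesgue_affine v s0 (mG i)) -FE muleA -EFinM.
  by rewrite mulVf ?gt_eqF// mul1e.
apply: lee_wpmul2l; first by rewrite lee_fin invr_ge0 ltW.
by apply: ereal_inf_lbound; exists G.
Qed.

(** The reverse inequality is the previous one for the inverse map. *)
Let mu_star_affine s v (A : set 'rV[R]_n) : s != 0 ->
  (mu_star A = (`|s| ^+ n)%:E * mu_star (affine s v @^-1` A))%E.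
Proof.
move=> s0; apply/eqP; rewrite eq_le mu_star_affine_le//=.
have sn0 : 0 < `|s| ^+ n by rewrite exprn_gt0// normr_gt0.
rewrite -lee_pdivlMl//.
have sV0 : s^-1 != 0 by rewrite invr_eq0.
apply: (le_trans (mu_star_affine_le (- (s^-1 *: v)) _ sV0)).
rewrite normfV exprVn; apply: lee_wpmul2l; first by rewrite lee_fin invr_ge0 ltW.
rewrite (_ : _ @^-1` _ = A)//.
by apply/funext => x; rewrite /preimage/= affineVK.
Qed.

Lemma lebesgue_affine s v (A : set (lebesgue_space R n)) : s != 0 ->
  lebesgue_rV A = ((`|s| ^+ n)%:E *
    lebesgue_rV ((affine s v : lebesgue_space R n -> lebesgue_space R n) @^-1` A))%E.
Proof. exact: mu_star_affine. Qed.

(** Every test set [X] of the Caratheodory criterion is a preimage of some [Y], and the outer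
    measures of all preimages carry the same factor, so the criterion for [A] transfers. *)
Lemma measurable_affine_lebesgue s v : s != 0 ->
  measurable_fun setT (affine s v : lebesgue_space R n -> lebesgue_space R n).
Proof.
move=> s0 _ A mA; rewrite setTI.
suff : mu_star.-caratheodory (affine s v @^-1` A) by [].
have {}mA : mu_star.-caratheodory A := mA.
move=> X.
have sn0 : 0 < `|s| ^+ n by rewrite exprn_gt0// normr_gt0.
pose Y := affine s^-1 (- (s^-1 *: v)) @^-1` X.
have XE : X = affine s v @^-1` Y.
  by apply/funext => x; rewrite /Y /preimage/= affineK.
have sV Z : mu_star (affine s v @^-1` Z) = ((`|s| ^+ n)^-1%:E * mu_star Z)%E.
  by rewrite (@mu_star_affine s v Z s0) muleA -EFinM mulVf ?gt_eqF// mul1e.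
rewrite XE; transitivity (mu_star (affine s v @^-1` (Y `&` A)) +
    mu_star (affine s v @^-1` (Y `&` ~` A)))%E; last by [].
by rewrite !sV -ge0_muleDr ?mu_ext_ge0//; congr (_ * _)%E; exact: mA.
Qed.

Lemma lebesgue_borelE (A : set 'rV[R]_n) :
  measurable A -> lebesgue_rV (A : set (lebesgue_space R n)) = borel_lebesgue R n A.
Proof. exact: measurable_mu_extE. Qed.

Lemma measurable_borel_lebesgue (A : set 'rV[R]_n) :
  measurable A -> measurable (A : set (lebesgue_space R n)).
Proof. exact: caratheodory_measurable_mu_ext. Qed.

Lemma measurable_fun_borel_lebesgue d (T : measurableType d) (f : 'rV[R]_n -> T) :
  measurable_fun setT f -> measurable_fun setT (f : lebesgue_space R n -> T).
Proof.
move=> mf _ A mA; rewrite setTI; apply: measurable_borel_lebesgue.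
exact: measurable_preimage.
Qed.

Lemma lebesgue_reflect (x : 'rV[R]_n) (A : set (lebesgue_space R n)) :
  lebesgue_rV ((fun y => x - y) @^-1` A) = lebesgue_rV A.
Proof.
have N0 : (-1 : R) != 0 by rewrite oppr_eq0 oner_eq0.
rewrite (lebesgue_affine x A N0) normrN1 expr1n mul1e.
congr (lebesgue_rV _); apply/funext => y.
by rewrite /preimage/= /affine scaleN1r addrC.
Qed.

Lemma measurable_reflect (x : 'rV[R]_n) :
  measurable_fun setT ((fun y => x - y) : lebesgue_space R n -> lebesgue_space R n).
Proof.
have N0 : (-1 : R) != 0 by rewrite oppr_eq0 oner_eq0.
rewrite (_ : (fun y => _) = affine (-1) x); first exact: measurable_affine_lebesgue.
by apply/funext => y; rewrite /affine scaleN1r addrC.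
Qed.

End lebesgue_affine_completion.

(** * The Euclidean norm and the radial projection *)

Section euclidean_norm.
Variables (R : realType) (n : nat).
Implicit Types (x y : 'rV[R]_n) (t : R).

Lemma enorm_ge0 x : 0 <= enorm x.
Proof. exact: sqrtr_ge0. Qed.

Lemma sqr_enorm x : enorm x ^+ 2 = \sum_(i < n) x ord0 i ^+ 2.
Proof. by rewrite sqr_sqrtr// sumr_ge0// => i _; rewrite sqr_ge0. Qed.

Lemma enormZ t x : enorm (t *: x) = `|t| * enorm x.
Proof.
rewrite /enorm -sqrtr_sqr -sqrtrM ?sqr_ge0//; congr Num.sqrt.
by rewrite mulr_sumr; apply: eq_bigr => i _; rewrite mxE exprMn.
Qed.

Lemma enormN x : enorm (- x) = enorm x.
Proof. by rewrite -scaleN1r enormZ normrN1 mul1r. Qed.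

Lemma ler_abs_enorm x i : `|x ord0 i| <= enorm x.
Proof.
rewrite -sqrtr_sqr ler_wsqrtr// (bigD1 i)//= lerDl.
by rewrite sumr_ge0// => j _; rewrite sqr_ge0.
Qed.

Lemma enorm_eq0 x : (enorm x == 0) = (x == 0).
Proof.
apply/eqP/eqP => [x0|->].
  apply/rowP => i; apply/eqP; rewrite mxE -normr_eq0 eq_le normr_ge0 andbT.
  by rewrite -x0 ler_abs_enorm.
by rewrite -(scale0r 0) enormZ normr0 mul0r.
Qed.

Lemma enorm_gt0 x : (0 < enorm x) = (x != 0).
Proof. by rewrite lt_neqAle eq_sym enorm_eq0 enorm_ge0 andbT. Qed.

Lemma enorm_radial x : x != 0 -> enorm (radial x) = 1.
Proof.
move=> x0; rewrite /radial enormZ gtr0_norm ?invr_gt0 ?enorm_gt0//.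
by rewrite mulVf// enorm_eq0.
Qed.

Lemma radialZ t x : 0 < t -> radial (t *: x) = radial x.
Proof.
move=> t0; rewrite /radial enormZ gtr0_norm// scalerA invfM.
by rewrite mulrC mulrA mulfV ?gt_eqF// mul1r.
Qed.

Lemma enorm_scale_radial x : enorm x *: radial x = x.
Proof.
have [->|x0] := eqVneq x 0; first by rewrite /radial !scaler0.
by rewrite /radial scalerA mulfV ?enorm_eq0// scale1r.
Qed.

Lemma measurable_radial : measurable_fun setT (@radial R n).
Proof.
apply: measurable_fun_rV => i.
rewrite (_ : _ \o _ = (fun x => (enorm x)^-1 * x ord0 i)); last first.
  by apply/funext => x; rewrite /= /rV_coord mxE.
apply: measurable_funM; last exact: (@measurable_rV_coord R n i).
by apply: measurable_funV_ge0; [exact: enorm_ge0|exact: measurable_enorm].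
Qed.

End euclidean_norm.

(** * Finiteness of the surface measure *)

Section surface_measure_finite.
Variables (R : realType) (n : nat).

Lemma measurable_dir :
  measurable_fun setT (@radial R n : lebesgue_space R n -> sphere_space R n).
Proof. by move=> _ A mA; rewrite setTI -[X in measurable X]setTI; exact: mA. Qed.

Lemma measurable_borel_sphere (A : set 'rV[R]_n) :
  measurable A -> measurable (A : set (sphere_space R n)).
Proof.
move=> mA; suff : measurable (@radial R n @^-1` A : set (lebesgue_space R n)).
  by move=> mA'; rewrite /measurable/= /sphere_measurable /image_set_system/= setTI.
apply: measurable_borel_lebesgue; apply: measurable_preimage => //.
exact: measurable_radial.
Qed.

Lemma measurable_fun_borel_sphere d (T : measurableType d) (f : 'rV[R]_n -> T) :
  measurable_fun setT f -> measurable_fun setT (f : sphere_space R n -> T).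
Proof.
move=> mf _ A mA; rewrite setTI; apply: measurable_borel_sphere.
exact: measurable_preimage.
Qed.

Lemma measurable_unit_sphere : measurable (@unit_sphere R n : set (sphere_space R n)).
Proof.
apply: measurable_borel_sphere.
rewrite (_ : @unit_sphere R n = @enorm R n @^-1` [set 1]); last by [].
by apply: measurable_preimage => //; exact: measurable_enorm.
Qed.

(** The punctured ball lies in a cube of side 2. *)
Lemma lebesgue_punctured_ball_fin :
  (lebesgue_rV (@punctured_ball R n : set (lebesgue_space R n)) < +oo)%E.
Proof.
pose a : 'rV[R]_n := const_mx (-1); pose b : 'rV[R]_n := const_mx 1.
pose box := [set x : 'rV[R]_n | forall i, `]a ord0 i, b ord0 i]%classic (x ord0 i)].
have : (borel_lebesgue R n box < +oo)%E.
  by rewrite borel_lebesgue_box ?ltry// => i; rewrite !mxE; lra.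
apply: le_lt_trans; have mbox : measurable box.
  rewrite (_ : box = \bigcap_(i in [set: 'I_n])
      (@rV_coord R n i @^-1` `]a ord0 i, b ord0 i]%classic)).
    apply: fin_bigcap_measurable => // i _.
    by apply: measurable_preimage => //; exact: measurable_rV_coord.
  by apply/seteqP; split=> x /= H i; [move=> _|]; exact: H.
rewrite -(lebesgue_borelE mbox); apply: le_measure; rewrite ?inE.
- exact: measurable_punctured_ball.
- exact: measurable_borel_lebesgue.
- move=> x /= /andP[_ x1] i; rewrite /= !mxE/= in_itv/=.
  have := le_lt_trans (ler_abs_enorm x i) x1.
  by rewrite ltr_norml => /andP[-> /ltW ->].
Qed.

Let surface_measure_fin : fin_num_fun (@surface_measure R n).
Proof.
apply: lty_fin_num_fun; rewrite [X in (X < _)%E](_ : _ = n%:R%:E *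
    lebesgue_rV (@punctured_ball R n : set (lebesgue_space R n)))%E; last first.
  by congr (_ * lebesgue_rV _)%E; apply/seteqP; split=> [x []|x].
by rewrite lte_mul_pinfty// ?lebesgue_punctured_ball_fin// lee_fin.
Qed.

HB.instance Definition _ := Measure_isFinite.Build _ _ _
  (@surface_measure R n) surface_measure_fin.

End surface_measure_finite.

(** * Lebesgue measure in polar coordinates *)

Section positive_half_line.
Variable R : realType.

Definition lebesgue_pos : set (measurableTypeR R) -> \bar R :=
  mrestr (@lebesgue_measure R) (measurable_itv `]0, +oo[).

HB.instance Definition _ := Measure.on lebesgue_pos.

Let lebesgue_pos_sigma_finite : sigma_finite setT lebesgue_pos.
Proof.
have [F TF Foo] := sigma_finiteT (@lebesgue_measure R).
exists F => // k; have [mF Fk] := Foo k; split => //.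
apply: le_lt_trans Fk; apply: le_measure; rewrite ?inE//; first exact: measurableI.
Qed.

HB.instance Definition _ := Measure_isSigmaFinite.Build _ _ _
  lebesgue_pos lebesgue_pos_sigma_finite.

End positive_half_line.

Section origin.
Variable R : realType.

Lemma measurable_origin n : measurable [set 0 : 'rV[R]_n].
Proof.
rewrite (_ : [set 0] = @enorm R n @^-1` [set 0]).
  by apply: measurable_preimage => //; exact: measurable_enorm.
by apply/seteqP; split=> x /= /eqP; [rewrite -enorm_eq0|rewrite enorm_eq0] => /eqP.
Qed.

(** One null coordinate suffices. Dimension 0 is excluded because the measure there is the Dirac
    mass at the origin. *)
Lemma lebesgue_origin0 n : (0 < n)%N ->
  lebesgue_rV ([set 0] : set (lebesgue_space R n)) = 0%E.
Proof.
move=> n_gt0; rewrite lebesgue_borelE; last exact: measurable_origin.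
case: n n_gt0 => // m _; rewrite /= /rV_cons_measure /pushforward.
have -> : @rV_cons R m @^-1` [set 0] = [set 0] `*` [set 0].
  apply/seteqP; split=> [p /= p0|[x y]/= [-> ->]].
    rewrite -(rV_consK p) p0 /rV_uncons mxE; split=> //.
    by apply/rowP => i; rewrite !mxE.
  by apply/rowP => i; rewrite !mxE; case: unliftP => // j _; rewrite mxE.
rewrite product_measure1E//; last exact: measurable_origin.
rewrite [X in (X * _)%E](_ : _ = 0%E) ?mul0e//.
exact: lebesgue_measure_set1.
Qed.

End origin.

Section polar.
Variables (R : realType) (n : nat).
Hypothesis n_gt0 : (0 < n)%N.

Let T := lebesgue_space R n.
Let S := sphere_space R n.

Definition nroot (t : R) : R := t `^ n%:R^-1.

Lemma nrootK t : 0 <= t -> nroot t ^+ n = t.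
Proof.
move=> t0; rewrite /nroot -powR_mulrn ?powR_ge0// -powRrM mulVf ?pnatr_eq0 -?lt0n//.
by rewrite powRr1.
Qed.

Lemma nroot_gt0 t : 0 < t -> 0 < nroot t.
Proof. exact: powR_gt0. Qed.

Lemma exprnK_nroot t : 0 <= t -> nroot (t ^+ n) = t.
Proof.
move=> t0; apply/eqP; rewrite -(@eqrXn2 R n)// ?powR_ge0//.
by rewrite nrootK ?exprn_ge0.
Qed.

(* The first coordinate is [|z|^n] rather than [|z|], so that the radial factor
   of Lebesgue measure is Lebesgue measure itself. *)
Definition polar (z : T) : measurableTypeR R * S := (enorm z ^+ n, radial z).

Lemma measurable_polar_radius :
  measurable_fun setT (fun z : T => enorm z ^+ n : measurableTypeR R).
Proof.
apply: measurable_funX; apply: measurable_fun_borel_lebesgue.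
exact: measurable_enorm.
Qed.

Lemma measurable_polar : measurable_fun setT polar.
Proof.
apply: measurable_fun_pair; first exact: measurable_polar_radius.
exact: measurable_dir.
Qed.

(** The truncated cone over [A] is the dilation by [nroot t] of the one that defines the surface
    measure, so its volume is multiplied by t. *)
Let lebesgue_cone (A : set S) (t : R) : measurable A -> 0 < t ->
  (n%:R%:E * lebesgue_rV
    ((fun z : T => (enorm z ^+ n)%R : measurableTypeR R) @^-1` `]-oo, t[ `&`
     (@radial R n : T -> S) @^-1` A) = t%:E * surface_measure A)%E.
Proof.
move=> mA t0; set D := (X in lebesgue_rV X).
have mdA : measurable ((@radial R n : T -> S) @^-1` A).
  by apply: measurable_preimage; [exact: measurable_dir|exact: mA].
have m0 : measurable ([set 0] : set T).
  exact: (measurable_borel_lebesgue (@measurable_origin R n)).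
have mD : measurable D.
  apply: measurableI => //.
  exact: (measurable_preimage measurable_polar_radius (measurable_itv `]-oo, t[)).
(* [radial] sends 0 to 0, which may belong to [A], whereas the surface measure only sees the
   punctured ball; the origin is null and can be removed. *)
pose E := D `\` [set 0].
have -> : lebesgue_rV D = lebesgue_rV E.
  have mE : measurable E by exact: measurableD.
  have l0 := lebesgue_origin0 R n_gt0.
  rewrite -(measureU0 mE m0 l0) -(measureU0 mD m0 l0); congr (lebesgue_rV _).
  by rewrite /E setDE [RHS]setUIl (setUC (~` _)) setUv setIT.
have s0 := nroot_gt0 t0.
rewrite (lebesgue_affine 0 E (lt0r_neq0 s0)) gtr0_norm// nrootK ?ltW//.
rewrite muleCA; congr (_ * (_ * lebesgue_rV _))%E.
have radialE z : affine (nroot t) 0 z = nroot t *: z by rewrite /affine addr0.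
apply/seteqP; split=> z /=; rewrite /E /D /punctured_ball/= radialE in_itv/=
  radialZ// enormZ gtr0_norm// exprMn nrootK ?ltW//.
- move=> [[zt Az] z0]; split=> //; rewrite enorm_gt0.
  have -> : z != 0 by apply/eqP => zE; apply: z0; rewrite zE scaler0.
  by move: zt; rewrite gtr_pMr// expr_lt1 ?enorm_ge0.
- move=> [Az /andP[z0 z1]]; split; first split=> //.
    by rewrite gtr_pMr// expr_lt1 ?enorm_ge0.
  move/eqP; rewrite scaler_eq0 gt_eqF//= => /eqP zE.
  by move: z0; rewrite enorm_gt0 zE eqxx.
Qed.

(** For fixed [A] both sides are measures in [I]. They agree on the rays ]-oo, t[, which are stable
    under intersection, generate the Borel sets and exhaust the line with finite measure. *)
Let lebesgue_polar_rect (A : set S) : measurable A -> forall I, measurable I ->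
  (n%:R%:E * lebesgue_rV
    ((fun z : T => (enorm z ^+ n)%R : measurableTypeR R) @^-1` I `&`
     (@radial R n : T -> S) @^-1` A) = lebesgue_pos I * surface_measure A)%E.
Proof.
move=> mA I mI.
have mdA : measurable ((@radial R n : T -> S) @^-1` A).
  by apply: measurable_preimage; [exact: measurable_dir|exact: mA].
have sA : (surface_measure A \is a fin_num)%E by exact: fin_num_measure.
have sA0 : 0 <= fine (surface_measure A) by exact: fine_ge0.
pose m1 : {measure set _ -> \bar R} := mscale (NngNum (ler0n R n))
  (image_measure (mrestr (@lebesgue_rV R n) mdA) measurable_polar_radius).
pose m2 : {measure set _ -> \bar R} :=
  mscale (NngNum sA0) (@lebesgue_pos R).
have m2I J : m2 J = (lebesgue_pos J * surface_measure A)%E.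
  by rewrite muleC -[in RHS](fineK sA).
rewrite -m2I; change (m1 I = m2 I).
pose g k : set (measurableTypeR R) := `]-oo, (k%:R : R)[%classic.
(* The maximum with 0 accounts for t <= 0, where no vector satisfies |z|^n < t. *)
have m1E t : m1 `]-oo, t[%classic = ((Num.max 0 t)%:E * surface_measure A)%E.
  have [t0|t0] := ltP 0 t; first exact: lebesgue_cone.
  rewrite mul0e [LHS](_ : _ = (n%:R%:E * lebesgue_rV (set0 : set T))%E).
    by rewrite measure0 mule0.
  congr (_ * lebesgue_rV _)%E; apply/seteqP; split=> [z [/=]|//].
  rewrite in_itv/= => zt; have := lt_le_trans zt t0.
  by rewrite ltNge exprn_ge0// enorm_ge0.
have m2E t : m2 `]-oo, t[%classic = ((Num.max 0 t)%:E * surface_measure A)%E.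
  rewrite m2I; congr (_ * _)%E.
  rewrite /lebesgue_pos /mrestr (_ : _ `&` _ = `]0, t[%classic); last first.
    by apply/seteqP; split=> x /=; rewrite !in_itv/= andbT;
      [move=> [-> ->]|move=> /andP[]].
  apply: etrans (lebesgue_measure_itv _) _.
  by rewrite /= lte_fin; case: (ltP 0 t) => // _; rewrite sube0.
apply: (@measure_unique _ R (measurableTypeR R) (@RGenInftyO.G R) g
  (RGenInftyO.measurableE R) _ _ _ m1 m2).
- move=> _ _ [x ->] [y ->]; exists (Num.min x y).
  by apply/seteqP; split=> z /=; rewrite !in_itv/= lt_min;
    [move=> [-> ->]|move=> /andP[]].
- by move=> k; exists k%:R.
- apply/seteqP; split=> // x _; exists (Num.truncn `|x|).+1 => //=.
  by rewrite /g/= in_itv/= (le_lt_trans (ler_norm x))// truncnS_gt.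
- by move=> _ [t ->]; rewrite m1E m2E.
- by move=> k; rewrite m1E -(fineK sA) -EFinM ltry.
- exact: mI.
Qed.

Lemma lebesgue_polar (X : set (measurableTypeR R * S)) : measurable X ->
  (n%:R%:E * lebesgue_rV (polar @^-1` X) =
   (@lebesgue_pos R \x @surface_measure R n) X)%E.
Proof.
move=> mX; pose m : {measure set _ -> \bar R} := mscale (NngNum (ler0n R n))
  (image_measure (@lebesgue_rV R n) measurable_polar).
rewrite (@product_measure_unique _ _ _ _ _ (@lebesgue_pos R) (@surface_measure R n) m)//.
by move=> I A mI mA; rewrite -lebesgue_polar_rect.
Qed.

End polar.

(** * The radial integral, and integration by reflection and in polar coordinates *)

Section lebesgue_pos_integral.
Variable R : realType.

(** In the coordinate t = |z|^n the factor |z|^(-n) of the kernel is 1/t, whose primitive is the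
    logarithm. *)
Lemma integral_lebesgue_pos_inv (a b : R) : 0 < a -> a < b ->
  (\int[@lebesgue_pos R]_t (\1_(`]a, b[%classic : set R) t * t `^ -1)%:E)%E =
  (ln b - ln a)%:E.
Proof.
move=> a0 ab.
transitivity (\int[@lebesgue_pos R]_(t in `]a, b[%classic) (t `^ -1)%:E)%E.
  rewrite [RHS]integral_mkcond; apply: eq_integral => t _.
  by rewrite patchE indicE; case: ifPn => _; rewrite ?mul1r ?mul0r.
rewrite (eq_measure_integral (@lebesgue_measure R)); last first.
  move=> A mA Aab.
  transitivity (lebesgue_measure (A `&` `]0%R, +oo[%classic)); first by [].
  rewrite setIidl// => t /Aab/=.
  by rewrite !in_itv/= andbT => /andP[at_ _]; exact: lt_trans at_.
have mf : measurable_fun `]a, b[ (fun t : R => (t `^ -1)%:E).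
  by apply: measurable_funTS; apply/measurable_EFinP; exact: measurable_powR.
rewrite -(integral_itv_bndoo true false)//.
have pos x : a <= x -> 0 < x by exact: lt_le_trans.
have cln x : a <= x -> {for x, continuous (@ln R)}.
  by move=> /pos; exact: continuous_ln.
transitivity (\int[@lebesgue_measure R]_(t in `[a, b]) (t^-1)%:E)%E.
  apply: eq_integral => t; rewrite inE/= in_itv/= => /andP[/pos t0 _].
  by rewrite powR_inv1 ?ltW.
rewrite (@continuous_FTC2 R GRing.inv (@ln R))//.
- apply: continuous_in_subspaceT => x; rewrite inE/= in_itv/= => /andP[ax _].
  by apply: inv_continuous; rewrite gt_eqF// pos.
- split.
  + move=> x; rewrite in_itv/= => /andP[/ltW/pos ax _].
    by have [] := is_derive1_ln ax.
  + by apply: cvg_at_right_filter; exact: cln.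
  + by apply: cvg_at_left_filter; apply: cln; exact: ltW.
- move=> x; rewrite in_itv/= => /andP[/ltW/pos ax _]; rewrite derive1E.
  by have [_ ->] := is_derive1_ln ax.
Qed.

End lebesgue_pos_integral.

Section integral_transfer.
Variables (R : realType) (n : nat).
Let T := lebesgue_space R n.
Let S := sphere_space R n.
Local Open Scope ereal_scope.

Lemma ge0_integral_reflect (x : 'rV[R]_n) (f : T -> \bar R) :
  measurable_fun setT f -> (forall z, 0 <= f z) ->
  \int[@lebesgue_rV R n]_y f (x - y)%R = \int[@lebesgue_rV R n]_z f z.
Proof.
move=> mf f0; set phi := (fun y : T => (x - y)%R : T).
have mphi : measurable_fun setT phi by exact: measurable_reflect.
transitivity (\int[image_measure (@lebesgue_rV R n) mphi]_z f z).
  by rewrite ge0_integral_pushforward.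
by apply: eq_measure_integral => A _ _; exact: lebesgue_reflect.
Qed.

Hypothesis n_gt0 : (0 < n)%N.

(** Tonelli, once [lebesgue_polar] identifies the product measure with the image under [polar] of n
    times Lebesgue measure. *)
Lemma ge0_integral_polar (G : measurableTypeR R * S -> \bar R) :
  measurable_fun setT G -> (forall p, 0 <= G p) ->
  n%:R%:E * \int[@lebesgue_rV R n]_z G (polar z) =
  \int[@surface_measure R n]_th \int[@lebesgue_pos R]_t G (t, th).
Proof.
move=> mG G0.
have n0 : (0 <= n%:R :> R)%R by [].
have mGp : measurable_fun setT (G \o @polar R n).
  exact: (measurableT_comp mG (@measurable_polar R n)).
rewrite -(@fubini_tonelli2 _ _ _ _ R (@lebesgue_pos R) (@surface_measure R n) G)//.
transitivity (\int[mscale (NngNum n0) (@lebesgue_rV R n)]_z G (polar z)).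
  by rewrite ge0_integral_mscale.
transitivity (\int[image_measure (mscale (NngNum n0) (@lebesgue_rV R n))
    (@measurable_polar R n)]_p G p).
  by rewrite ge0_integral_pushforward//; exact: measurable_polar.
apply: eq_measure_integral => X mX _.
transitivity (n%:R%:E * @lebesgue_rV R n (@polar R n @^-1` X)); first by [].
have h := lebesgue_polar n_gt0 mX; exact: h.
Qed.

End integral_transfer.

(** * Exit radii and the power of a point *)

Section ray.
Variables (R : realType) (n : nat).
Implicit Types a th : 'rV[R]_n.

Definition dotp a th : R := \sum_(i < n) a ord0 i * th ord0 i.

Lemma sqr_enormB a th (s : R) : enorm th = 1 ->
  enorm (a - s *: th) ^+ 2 = enorm a ^+ 2 - 2 * s * dotp a th + s ^+ 2.
Proof.
move=> th1; have -> : s ^+ 2 = s ^+ 2 * enorm th ^+ 2 by rewrite th1 expr1n mulr1.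
rewrite !sqr_enorm /dotp !mulr_sumr -sumrB -big_split/=; apply: eq_bigr => i _.
by rewrite !mxE; ring.
Qed.

(* The ray leaves the ball of radius r about a at the positive root of
   s^2 - 2 s (a . th) - (r^2 - |a|^2). *)
Definition exit_radius (q : R) a th : R :=
  dotp a th + Num.sqrt (dotp a th ^+ 2 + q).

Lemma dotpN a th : dotp a (- th) = - dotp a th.
Proof. by rewrite /dotp -sumrN; apply: eq_bigr => i _; rewrite mxE mulrN. Qed.

(** The two exit radii are s + p and s - p with s^2 = p^2 + q: this is the power of the point. *)
Lemma exit_radiusN (q : R) a th : 0 < q ->
  exit_radius q a th * exit_radius q a (- th) = q.
Proof.
move=> q0; rewrite /exit_radius dotpN sqrrN.
set p := dotp a th; set s := Num.sqrt _.
have : s ^+ 2 = p ^+ 2 + q by rewrite sqr_sqrtr// addr_ge0 ?sqr_ge0// ltW.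
by move=> h; transitivity (s ^+ 2 - p ^+ 2); [ring|rewrite h; ring].
Qed.

(** After squaring, the condition is (s - p)^2 < w^2. Since |p| < w, the root p - w is negative and
    only p + w constrains a positive s. *)
Lemma enormB_lt_exit_radius (r : R) a th (s : R) :
  0 < r -> enorm a < r -> enorm th = 1 -> 0 < s ->
  (enorm (a - s *: th) < r) = (s < exit_radius (r ^+ 2 - enorm a ^+ 2) a th).
Proof.
move=> r0 ar th1 s0; rewrite -(ltr_pXn2r (_ : (0 < 2)%N)) ?nnegrE ?enorm_ge0 ?ltW//.
rewrite sqr_enormB// /exit_radius; set p := dotp a th; set A := enorm a ^+ 2.
set w := Num.sqrt _.
have q0 : 0 < r ^+ 2 - A.
  by rewrite subr_gt0 /A ltr_pXn2r ?nnegrE ?enorm_ge0 ?ltW.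
have w2 : w ^+ 2 = p ^+ 2 + (r ^+ 2 - A).
  by rewrite sqr_sqrtr// addr_ge0 ?sqr_ge0// ltW.
have w0 : 0 <= w by exact: sqrtr_ge0.
have pw : `|p| < w.
  by rewrite -(ltr_pXn2r (_ : (0 < 2)%N)) ?nnegrE// w2 real_normK ?num_real// ltrDl.
have [pw1 pw2] : - w < p /\ p < w by move: pw; rewrite ltr_norml => /andP.
apply/idP/idP => h; nra.
Qed.

(** Exit radii have a common upper bound [D], and opposite ones multiply to q, so none is below q /
    D. *)
Lemma exit_radius_lower_bound (q : R) a : 0 < q ->
  exists2 d : R, 0 < d & forall th, enorm th = 1 -> d <= exit_radius q a th.
Proof.
move=> q0; pose M := \sum_(i < n) `|a ord0 i|; pose D := M + Num.sqrt (M ^+ 2 + q).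
have pM th : enorm th = 1 -> `|dotp a th| <= M.
  move=> th1; rewrite /dotp; apply: le_trans (ler_norm_sum _ _ _) _.
  apply: ler_sum => i _; rewrite normrM ler_piMr//.
  by have := ler_abs_enorm th i; rewrite th1.
have M0 : 0 <= M by rewrite sumr_ge0.
have D0 : 0 < D by rewrite ltr_wpDl// sqrtr_gt0 ltr_wpDl ?sqr_ge0.
have eD th : enorm th = 1 -> exit_radius q a th <= D.
  move=> /pM h; rewrite /exit_radius /D; apply: lerD.
    exact: le_trans (ler_norm _) h.
  rewrite ler_wsqrtr// lerD2r -[dotp _ _ ^+ 2]real_normK ?num_real//.
  by rewrite ler_pXn2r// nnegrE.
have e0 th : 0 < exit_radius q a th.
  rewrite /exit_radius -ltrBlDl sub0r (le_lt_trans (ler_norm _))// normrN.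
  rewrite -sqrtr_sqr ltr_sqrt ?ltrDl// ltr_wpDl ?sqr_ge0//.
exists (q / D); first exact: divr_gt0.
move=> th th1; rewrite ler_pdivrMr// -{1}(exit_radiusN a th q0) ler_pM2l//.
by apply: eD; rewrite enormN.
Qed.

End ray.

(** * The truncated kernel with a nonnegative factor in the direction *)

Section truncated_kernel.
Variables (R : realType) (n : nat) (a : 'rV[R]_n) (r d : R).
Let T := lebesgue_space R n.
Let S := sphere_space R n.
Implicit Types (v : S -> R) (z : T).

(** Written in the variable z = x - y with a = x - c, so that a - z = y - c. *)
Definition truncated_ball : set T := [set z | d < enorm z /\ enorm (a - z) < r].

Definition truncated_kernel v z : R :=
  \1_truncated_ball z * (v (radial z) * (enorm z ^+ n)^-1).

Lemma measurable_truncated_ball : measurable truncated_ball.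
Proof.
apply: measurable_borel_lebesgue.
rewrite (_ : truncated_ball = (@enorm R n @^-1` `]d, +oo[%classic) `&`
    ((@enorm R n \o affine (-1) a) @^-1` `]-oo, r[%classic)).
  apply: measurableI; apply: measurable_preimage => //; first exact: measurable_enorm.
  apply: measurableT_comp; [exact: measurable_enorm|exact: measurable_affine].
by apply/seteqP; split=> z; rewrite /truncated_ball/= /affine scaleN1r addrC
  !in_itv/= andbT.
Qed.

Lemma measurable_truncated_kernel v : measurable_fun setT v ->
  measurable_fun setT (truncated_kernel v).
Proof.
move=> mv; apply: measurable_funM.
  exact/measurable_indic/measurable_truncated_ball.
apply: measurable_funM; first exact: (measurableT_comp mv (@measurable_dir R n)).
apply: measurable_funV_ge0; last exact: measurable_polar_radius.
by move=> z; rewrite exprn_ge0 ?enorm_ge0.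
Qed.

Lemma truncated_kernel_ge0 v z : (forall th, 0 <= v th) -> 0 <= truncated_kernel v z.
Proof. by move=> v0; rewrite !mulr_ge0// invr_ge0 exprn_ge0 ?enorm_ge0. Qed.

(* The truncated ball, and its reflection for s = -1, in polar coordinates. *)
Let W (s : R) : set (measurableTypeR R * S) :=
  [set p | d ^+ n < p.1 /\ enorm (a - (s * nroot n p.1) *: (p.2 : 'rV[R]_n)) < r].

Let measurable_W s : measurable (W s).
Proof.
pose f (p : measurableTypeR R * S) : 'rV[R]_n :=
  a - (s * nroot n p.1) *: (p.2 : 'rV[R]_n).
have mf : measurable_fun setT f.
  apply: measurable_fun_rV => i.
  rewrite (_ : _ \o f =
      (fun p => a ord0 i - s * nroot n p.1 * (rV_coord i p.2 : R))); last first.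
    by apply/funext => p; rewrite /= /rV_coord /f !mxE.
  apply: measurable_funB => //; apply: measurable_funM.
    apply: measurable_funM => //.
    by apply: (measurableT_comp (measurable_powR _)); exact: measurable_fst.
  apply: (@measurableT_comp _ _ _ _ _ _ (rV_coord i : S -> R)).
    by apply: measurable_fun_borel_sphere; exact: (@measurable_rV_coord R n i).
  exact: measurable_snd.
rewrite (_ : W s = (fst @^-1` (`]d ^+ n, +oo[%classic : set (measurableTypeR R))) `&`
    ((@enorm R n \o f) @^-1` `]-oo, r[%classic)).
  apply: measurableI; apply: measurable_preimage => //.
  by apply: measurableT_comp => //; exact: measurable_enorm.
by apply/seteqP; split=> p; rewrite /W/= !in_itv/= andbT.
Qed.

Hypotheses (n_gt0 : (0 < n)%N) (r_gt0 : 0 < r).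
Hypotheses (a_lt_r : enorm a < r) (d_gt0 : 0 < d).
Let q := r ^+ 2 - enorm a ^+ 2.
Hypothesis d_lt_exit : forall th : 'rV[R]_n, enorm th = 1 -> d < exit_radius q a th.

Let q_gt0 : 0 < q.
Proof. by rewrite subr_gt0 ltr_pXn2r ?nnegrE ?enorm_ge0 ?ltW. Qed.

Let W1_polar z : W 1 (polar z) <-> truncated_ball z.
Proof.
rewrite /W /truncated_ball /polar/= exprnK_nroot ?enorm_ge0// mul1r.
by rewrite enorm_scale_radial ltr_pXn2r ?nnegrE ?enorm_ge0 ?ltW.
Qed.

Let WN1_polar z : W (-1) (polar z) <-> truncated_ball (0 - z).
Proof.
rewrite /W /truncated_ball /polar/= exprnK_nroot ?enorm_ge0// mulN1r sub0r.
by rewrite scaleNr enorm_scale_radial enormN ltr_pXn2r ?nnegrE ?enorm_ge0 ?ltW.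
Qed.

(** On a ray the ball condition bounds the n-th root of t by the exit radius; raising to the power n
    turns the section into an interval, whose ends are ordered by [d_lt_exit]. *)
Let W_section (s : R) (th : 'rV[R]_n) t : enorm (s *: th) = 1 ->
  \1_(W s) (t, th) =
  \1_(`]d ^+ n, exit_radius q a (s *: th) ^+ n[%classic : set R) t :> R.
Proof.
move=> th1; rewrite !indicE; congr (nat_of_bool _)%:R.
apply/idP/idP; rewrite !inE/= in_itv/=.
- move=> [dt]; have t0 : 0 < t by rewrite (lt_trans _ dt)// exprn_gt0.
  rewrite mulrC -scalerA enormB_lt_exit_radius// ?nroot_gt0// => h.
  rewrite dt/= -[ltLHS](nrootK n_gt0 (ltW t0)) ltr_pXn2r ?nnegrE ?ltW ?nroot_gt0//.
  by rewrite (lt_trans d_gt0)// d_lt_exit.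
- move=> /andP[dt te]; have t0 : 0 < t by rewrite (lt_trans _ dt)// exprn_gt0.
  split=> //; rewrite mulrC -scalerA enormB_lt_exit_radius// ?nroot_gt0//.
  move: te; rewrite -[ltLHS](nrootK n_gt0 (ltW t0)) ltr_pXn2r ?nnegrE ?ltW ?nroot_gt0//.
  by rewrite (lt_trans d_gt0)// d_lt_exit.
Qed.

Let inner (s : R) (th : 'rV[R]_n) : enorm (s *: th) = 1 ->
  (\int[@lebesgue_pos R]_t (\1_(W s) (t, th) * t `^ -1)%:E)%E =
  (ln (exit_radius q a (s *: th) ^+ n) - ln (d ^+ n))%:E.
Proof.
move=> th1; rewrite -integral_lebesgue_pos_inv ?exprn_gt0//.
  by apply: eq_integral => t _; rewrite W_section.
rewrite ltr_pXn2r ?nnegrE ?(ltW d_gt0) ?d_lt_exit//.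
by rewrite (ltW (lt_trans d_gt0 _))// d_lt_exit.
Qed.

(* Adding the reflected integral makes the radial factor independent of the
   direction, because the two exit radii of a line multiply to q. *)
Lemma integral_truncated_kernel : exists C : R, forall v,
  measurable_fun setT v -> (forall th, 0 <= v th) ->
  (forall th : 'rV[R]_n, enorm th != 1 -> v th = 0) ->
  (forall th : 'rV[R]_n, v (- th) = v th) ->
  (\int[@lebesgue_rV R n]_z (truncated_kernel v z)%:E =
   C%:E * \int[@surface_measure R n]_th (v th)%:E)%E.
Proof.
(* This is the sum of the logarithmic integrals over two opposite rays. The maximum with 0 gives
   nonnegativity without choosing a unit vector; for any unit vector it equals its second
   argument. *)
pose C := Num.max 0 (ln (q ^+ n) - 2 * ln (d ^+ n)).
(* The factor 2 comes from adding the reflection, and n from the polar formula. *)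
exists (C / (2 * n%:R)) => v mv v0 voff veven.
set F := fun z : T => (truncated_kernel v z)%:E.
have mF : measurable_fun setT F.
  by apply/measurable_EFinP; exact: measurable_truncated_kernel.
have F0 z : (0 <= F z)%E by rewrite lee_fin truncated_kernel_ge0.
pose H s (p : measurableTypeR R * S) : \bar R := (\1_(W s) p * p.1 `^ -1)%:E.
have mH s : measurable_fun setT (H s).
  apply/measurable_EFinP; apply: measurable_funM; first exact: measurable_indic.
  by apply: (measurableT_comp (measurable_powR _)); exact: measurable_fst.
have H0 s p : (0 <= H s p)%E by rewrite lee_fin mulr_ge0// powR_ge0.
pose G (p : measurableTypeR R * S) : \bar R :=
  ((v p.2)%:E * (H 1%R p + H (-1)%R p))%E.
have mG : measurable_fun setT G.
  apply: emeasurable_funM; last exact: emeasurable_funD.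
  by apply/measurable_EFinP; apply: (measurableT_comp mv); exact: measurable_snd.
have G0 p : (0 <= G p)%E by apply: mule_ge0; [rewrite lee_fin|exact: adde_ge0].
(* Evenness of [v] lets the two reflected terms share the factor [v p.2]. *)
have GF z : G (polar z) = (F z + F (0 - z)%R)%E.
  rewrite /G /F /H /truncated_kernel /= powR_inv1 ?exprn_ge0 ?enorm_ge0//.
  have -> : radial (0 - z) = - radial z by rewrite /radial sub0r enormN scalerN.
  rewrite veven -!EFinD -EFinM !indicE; congr EFin.
  rewrite (_ : (polar z \in W 1) = (z \in truncated_ball)); last first.
    by apply/idP/idP; rewrite !inE => /W1_polar.
  rewrite (_ : (polar z \in W (-1)) = (0 - z \in truncated_ball)); last first.
    by apply/idP/idP; rewrite !inE => /WN1_polar.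
  by rewrite sub0r enormN; ring.
have mFN : measurable_fun setT (fun z : T => F (0 - z)).
  by apply: (measurableT_comp mF); exact: measurable_reflect.
have intG : (\int[@lebesgue_rV R n]_z G (polar z) =
    2%:E * \int[@lebesgue_rV R n]_z F z)%E.
  under eq_integral do rewrite GF.
  by rewrite ge0_integralD// ge0_integral_reflect// mule_natl mule2n.
have innerG (th : 'rV[R]_n) :
    (\int[@lebesgue_pos R]_t G (t, th) = C%:E * (v th)%:E)%E.
  (* The surface measure is carried by all of ['rV_n]; off the unit sphere both sides vanish with
     [v]. *)
  have [th1|th1] := eqVneq (enorm th) 1; last first.
    rewrite voff// mule0 integral0_eq// => t _; by rewrite /G/= voff// mul0e.
  have mHt s : measurable_fun setT (fun t : measurableTypeR R => H s (t, th : S)).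
    by apply: (measurableT_comp (mH s)); exact: measurable_fun_pair.
  transitivity (\int[@lebesgue_pos R]_t
      ((v th)%:E * (H 1%R (t, th) + H (-1)%R (t, th))))%E; first by [].
  rewrite ge0_integralZl//; last 3 first.
  - exact: emeasurable_funD.
  - by move=> t _; rewrite adde_ge0.
  - by rewrite lee_fin.
  rewrite ge0_integralD// !inner ?scale1r ?scaleN1r ?enormN// -EFinD muleC.
  congr (_%:E * _)%E.
  have e0 : 0 < exit_radius q a th by rewrite (lt_trans d_gt0)// d_lt_exit.
  have eN0 : 0 < exit_radius q a (- th).
    by rewrite (lt_trans d_gt0)// d_lt_exit// enormN.
  have lnd s : d < s -> ln (d ^+ n) <= ln (s ^+ n).
    move=> ds; have s0 := lt_trans d_gt0 ds.
    by rewrite ler_ln ?posrE ?exprn_gt0//; apply: lerXn2r; rewrite ?nnegrE ltW.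
  have h1 := lnd _ (d_lt_exit th1).
  have h2 : ln (d ^+ n) <= ln (exit_radius q a (- th) ^+ n).
    by apply/lnd/d_lt_exit; rewrite enormN.
  have lnq : ln (q ^+ n) =
      ln (exit_radius q a th ^+ n) + ln (exit_radius q a (- th) ^+ n).
    by rewrite -lnM ?posrE ?exprn_gt0// -exprMn exit_radiusN.
  by rewrite /C lnq max_r; lra.
have := ge0_integral_polar n_gt0 mG G0; rewrite intG.
have -> : (\int[@surface_measure R n]_th \int[@lebesgue_pos R]_t G (t, th) =
    C%:E * \int[@surface_measure R n]_th (v th)%:E)%E.
  transitivity (\int[@surface_measure R n]_th (C%:E * (v th)%:E))%E.
    by apply: eq_integral => th _; exact: innerG.
  apply: ge0_integralZl.
  - by [].
  - exact/measurable_EFinP.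
  - by move=> th _; rewrite lee_fin.
  - by rewrite lee_fin le_max lexx.
have n0 : (n%:R : R) != 0 by rewrite pnatr_eq0 -lt0n.
move=> h; rewrite EFinM muleAC -h muleC !muleA -!EFinM.
by rewrite (_ : _ * _ = 1 :> R) ?mul1e//; field.
Qed.

End truncated_kernel.

(** * Real kernels of mean zero *)

Section signed_kernel.
Variables (R : realType) (n : nat) (u : 'rV[R]_n -> R).
Hypothesis n_gt0 : (0 < n)%N.
Hypothesis u_homogeneous : forall (t : R) (x : 'rV[R]_n),
  0 < t -> x != 0 -> u (t *: x) = u x.
Hypothesis u_even : forall x : 'rV[R]_n, x != 0 -> u (- x) = u x.
Hypothesis u_integrable :
  (@surface_measure R n).-integrable (@unit_sphere R n) (EFin \o u).
Hypothesis u_mean0 :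
  (\int[@surface_measure R n]_(th in @unit_sphere R n) (u th)%:E = 0)%E.

Variables (c x : 'rV[R]_n) (r : R).
Hypotheses (r_gt0 : 0 < r) (x_ball : enorm (x - c) < r).

Let T := lebesgue_space R n.
Let S := sphere_space R n.
(** The cut-off lets surface integrals run over the whole space and makes evenness hold at every
    vector, 0 included. *)
Let us : S -> R := u \_ (@unit_sphere R n).

Let us_sphere (th : 'rV[R]_n) : enorm th = 1 -> us th = u th.
Proof. by move=> th1; rewrite /us patchE mem_set. Qed.

Let us_off (th : 'rV[R]_n) : enorm th != 1 -> us th = 0.
Proof. by move=> /eqP th1; rewrite /us patchE memNset. Qed.

Let us_even (th : 'rV[R]_n) : us (- th) = us th.
Proof.
have [th1|th1] := eqVneq (enorm th) 1; last by rewrite !us_off ?enormN.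
rewrite !us_sphere ?enormN// u_even//.
by rewrite -enorm_gt0 th1.
Qed.

Let us_integrable : (@surface_measure R n).-integrable setT (EFin \o us).
Proof.
rewrite /us -restrict_EFin; apply/(integrable_mkcond _ _).1 => //.
exact: measurable_unit_sphere.
Qed.

Let measurable_us : measurable_fun setT us.
Proof. by apply/measurable_EFinP; exact: measurable_int us_integrable. Qed.

Let us_mean0 : (\int[@surface_measure R n]_th (us th)%:E = 0)%E.
Proof.
rewrite -u_mean0 [RHS]integral_mkcond; apply: eq_integral => th _.
by rewrite /us !patchE; case: ifP.
Qed.

Definition cz_real_integrand (y : T) : R :=
  \1_(eball c r) y * (u (x - y) / enorm (x - y) ^+ n).

(** On the domain x - y is nonzero, so homogeneity moves [u] to a unit vector; elsewhere both sides
    are 0. *)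
Let truncated_integrand (d : R) (y : T) : 0 < d ->
  (cz_real_integrand \_ (cz_domain x d)) y = truncated_kernel (x - c) r d us (x - y).
Proof.
move=> d0; rewrite /truncated_kernel patchE.
have acE : x - c - (x - y) = y - c by rewrite opprB addrC addrA subrK.
case: ifPn => [|].
- rewrite inE /cz_domain/= => dxy.
  have xy0 : x - y != 0 by rewrite -enorm_gt0 (lt_trans d0).
  rewrite us_sphere ?enorm_radial// u_homogeneous ?invr_gt0 ?enorm_gt0//.
  rewrite /cz_real_integrand !indicE; congr ((_ : bool)%:R * _).
  apply/idP/idP; rewrite !inE/truncated_ball/eball/= acE; first by [].
  by move=> [].
- rewrite notin_setE => dxy; rewrite indicE memNset ?mul0r//.
  by rewrite /truncated_ball/= => -[].
Qed.

Let a := x - c.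
Let q := r ^+ 2 - enorm a ^+ 2.

(** The same constant [C] serves for |us| and for the positive and negative parts of [us]: the first
    gives integrability, and the last two have equal surface integrals by the mean-zero
    condition. *)
Let kernel_small (d : R) : 0 < d ->
  (forall th : 'rV[R]_n, enorm th = 1 -> d < exit_radius q a th) ->
  (@lebesgue_rV R n).-integrable setT
    (fun y : T => (truncated_kernel a r d us (x - y))%:E) /\
  (\int[@lebesgue_rV R n]_y (truncated_kernel a r d us (x - y))%:E = 0)%E.
Proof.
move=> d0 hd.
have [C HC] := integral_truncated_kernel n_gt0 r_gt0 x_ball d0 hd.
pose K (v : S -> R) (y : T) := (truncated_kernel a r d v (x - y))%:E.
have mK (v : S -> R) : measurable_fun setT v -> measurable_fun setT (K v).
  move=> mv; apply: (@measurableT_comp _ _ _ _ _ _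
    (fun z : T => (truncated_kernel a r d v z)%:E)).
    by apply/measurable_EFinP; exact: measurable_truncated_kernel.
  exact: measurable_reflect.
have intK (v : S -> R) : measurable_fun setT v -> (forall th, 0 <= v th) ->
  (forall th : 'rV[R]_n, enorm th != 1 -> v th = 0) ->
  (forall th : 'rV[R]_n, v (- th) = v th) ->
  (\int[@lebesgue_rV R n]_y K v y =
   C%:E * \int[@surface_measure R n]_th (v th)%:E)%E.
  move=> mv v0 voff veven; rewrite -HC//.
  apply: (@ge0_integral_reflect R n x
    (fun z : T => (truncated_kernel a r d v z)%:E)).
    by apply/measurable_EFinP; exact: measurable_truncated_kernel.
  by move=> z; rewrite lee_fin truncated_kernel_ge0.
(* The condition h 0 = 0 keeps the composite zero off the sphere. *)
have intKc (h : R -> R) : measurable_fun setT h -> (forall s, 0 <= h s) -> h 0 = 0 ->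
  (\int[@lebesgue_rV R n]_y K (h \o us) y =
   C%:E * \int[@surface_measure R n]_th (h (us th))%:E)%E.
  move=> mh h0 h00; apply: intK.
  - exact: measurableT_comp.
  - by move=> th; exact: h0.
  - by move=> th th1; rewrite /= us_off.
  - by move=> th; rewrite /= us_even.
have Kabs y : (`|K us y| = K (Num.norm \o us) y)%E.
  rewrite /K /truncated_kernel /= !normrM; congr ((_ * (_ * _))%:E).
    by rewrite ger0_norm.
  by rewrite ger0_norm// invr_ge0 exprn_ge0 ?enorm_ge0.
have Kmax (e : R) (v : S -> R) (y : T) :
    (Num.max (e * truncated_kernel a r d v (x - y)) 0 =
    truncated_kernel a r d (fun th => Num.max (e * v th) 0) (x - y)).
  rewrite /truncated_kernel; set i := \1__ _; set w := _^-1.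
  have i0 : 0 <= i by [].
  have w0 : 0 <= w by rewrite invr_ge0 exprn_ge0 ?enorm_ge0.
  by rewrite maxr_pMl// mul0r maxr_pMr// mulr0; congr Num.max; ring.
(* [h 1] and [h (-1)] are the positive and the negative part. *)
pose h (e s : R) := Num.max (e * s) 0.
have inth (e : R) : (\int[@lebesgue_rV R n]_y K (h e \o us) y =
    C%:E * \int[@surface_measure R n]_th (h e (us th))%:E)%E.
  apply: intKc; last by rewrite /h mulr0 maxxx.
    by apply: measurable_maxr => //; exact: measurable_funM.
  by move=> s; rewrite /h le_max lexx orbT.
have Kpos : (K us)^\+%E = K (h 1 \o us).
  apply/funext => y; rewrite funeposE /K -EFin_max; congr EFin.
  by rewrite -[X in Num.max X]mul1r Kmax.
have Kneg : (K us)^\-%E = K (h (-1) \o us).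
  apply/funext => y; rewrite funenegE /K -EFinN -EFin_max; congr EFin.
  by rewrite -[X in Num.max X]mulN1r Kmax.
have usfin : (\int[@surface_measure R n]_th `|(us th)%:E| \is a fin_num)%E.
  have /integrableP[_ us_lty] := us_integrable.
  by rewrite ge0_fin_numE// integral_ge0.
have uspos : (\int[@surface_measure R n]_th (h 1 (us th))%:E =
    \int[@surface_measure R n]_th (EFin \o us)^\+ th)%E.
  by apply: eq_integral => th _; rewrite funeposE /h mul1r EFin_max.
have usneg : (\int[@surface_measure R n]_th (h (-1) (us th))%:E =
    \int[@surface_measure R n]_th (EFin \o us)^\- th)%E.
  by apply: eq_integral => th _; rewrite funenegE /h mulN1r EFin_max EFinN.
split; last first.
  rewrite -/(K us) integralE Kpos Kneg !inth uspos usneg.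
  have P : (\int[@surface_measure R n]_th (EFin \o us)^\+ th \is a fin_num)%E.
    exact: integrable_pos_fin_num.
  have N : (\int[@surface_measure R n]_th (EFin \o us)^\- th \is a fin_num)%E.
    exact: integrable_neg_fin_num.
  (* Mean zero says that the two parts have equal integrals; these are finite, so the difference of
     their multiples by [C] is a genuine 0. *)
  have := us_mean0; rewrite integralE -[LHS]/(_ - _)%E => /eqP.
  rewrite sube_eq ?fin_num_adde_defl// add0e => /eqP ->.
  by rewrite subee// fin_numM.
apply/integrableP; split; first exact: mK.
rewrite (eq_integral (K (Num.norm \o us))); last by move=> y _; exact: Kabs.
rewrite (intKc (fun s => `|s|))//; last by rewrite normr0.
by rewrite -(fineK usfin) -EFinM ltry.
Qed.

Let measurable_cz_domain d : measurable (cz_domain x d : set T).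
Proof.
rewrite (_ : cz_domain x d =
    (fun y : T => x - y : T) @^-1` ((@enorm R n @^-1` `]d, +oo[%classic) : set T)).
  apply: measurable_preimage; first exact: measurable_reflect.
  apply: measurable_borel_lebesgue; apply: measurable_preimage => //.
  exact: measurable_enorm.
by apply/seteqP; split=> y; rewrite /cz_domain/= in_itv/= andbT.
Qed.

(** [d0] is the common lower bound of the exit radii from x, so every smaller truncation radius
    satisfies [kernel_small]. *)
Lemma cz_real_integrand_small : exists2 d0 : R, 0 < d0 & forall d, 0 < d < d0 ->
  (@lebesgue_rV R n).-integrable (cz_domain x d) (EFin \o cz_real_integrand) /\
  (\int[@lebesgue_rV R n]_(y in cz_domain x d) (cz_real_integrand y)%:E = 0)%E.
Proof.
have q0 : 0 < q by rewrite subr_gt0 ltr_pXn2r ?nnegrE ?enorm_ge0 ?ltW.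
have [d0 d0_gt0 hd0] := exit_radius_lower_bound a q0.
exists d0 => // d /andP[d_gt0 dd0].
have [Kint K0] := kernel_small d_gt0 (fun th th1 => lt_le_trans dd0 (hd0 th th1)).
split.
  apply/(integrable_mkcond _ (measurable_cz_domain d)).
  rewrite restrict_EFin; apply: eq_integrable Kint => // y _.
  by rewrite /= truncated_integrand.
rewrite integral_mkcond -[RHS]K0; apply: eq_integral => y _.
by rewrite -(truncated_integrand y d_gt0) !patchE; case: ifP.
Qed.

(** A large truncation radius gives a smaller domain, so integrability restricts from a radius [e]
    below [d0]. *)
Lemma cz_real_integrand_integrable (d : R) : 0 < d ->
  (@lebesgue_rV R n).-integrable (cz_domain x d) (EFin \o cz_real_integrand).
Proof.
move=> d_gt0; have [d0 d0_gt0 small] := cz_real_integrand_small.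
pose e := Num.min d (d0 / 2).
have e0 : 0 < e < d0.
  rewrite lt_min d_gt0 divr_gt0//= gt_min; apply/orP; right.
  by rewrite ltr_pdivrMr// ltr_pMr// ltr1n.
have [eint _] := small _ e0; apply: integrableS eint => //.
by move=> y; apply: le_lt_trans; rewrite ge_min lexx.
Qed.

End signed_kernel.

(** * Complex kernels, through real and imaginary parts *)

Section complex_parts.
Variables (R : realType) (n : nat) (omega : 'rV[R]_n -> R[i]).
Variables (c x : 'rV[R]_n) (r : R).

Let chi : 'rV[R]_n -> R[i] := \1_(eball c r).

(** The indicator and |x - y|^n are real, so the two parts of omega separate. *)
Let integrandE (y : 'rV[R]_n) : cz_integrand (cz_kernel omega) chi x y =
  Complex (cz_real_integrand (fun z => complex.Re (omega z)) c x r y)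
          (cz_real_integrand (fun z => complex.Im (omega z)) c x r y).
Proof.
rewrite /cz_integrand /cz_kernel /chi /cz_real_integrand !indicE.
rewrite -(rmorph_nat (real_complex R)) -fmorphV.
by case: (omega (x - y)) => s t /=; simpc; congr Complex; ring.
Qed.

Lemma Re_cz_integrand y :
  complex.Re (cz_integrand (cz_kernel omega) chi x y) =
  cz_real_integrand (fun z => complex.Re (omega z)) c x r y.
Proof. by rewrite integrandE. Qed.

Lemma Im_cz_integrand y :
  complex.Im (cz_integrand (cz_kernel omega) chi x y) =
  cz_real_integrand (fun z => complex.Im (omega z)) c x r y.
Proof. by rewrite integrandE. Qed.

End complex_parts.

Theorem lemma3 (R : realType) (n : nat) (omega : 'rV[R]_n -> R[i])
    (n_gt0 : (0 < n)%N)
    (omega_homogeneous : forall (t : R) (x : 'rV[R]_n),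
      0 < t -> x != 0 -> omega (t *: x) = omega x)
    (omega_even : forall x : 'rV[R]_n, x != 0 -> omega (- x) = omega x)
    (omega_integrable :
      cintegrable (@surface_measure R n) (@unit_sphere R n) omega)
    (omega_mean0 :
      cintegral (@surface_measure R n) (@unit_sphere R n) omega = 0)
    (c : 'rV[R]_n) (r : R) (r_gt0 : 0 < r) :
  let K := cz_kernel omega in
  let B := eball c r in
  let chi_B := \1_B : 'rV[R]_n -> R[i] in
  (forall x, B x -> cz_defined K chi_B x) /\
  (forall x, cz_operator K chi_B x * chi_B x = 0).
Proof.
move=> K B chi_B.
pose ure z := complex.Re (omega z); pose uim z := complex.Im (omega z).
have [re_int im_int] := omega_integrable.
case: omega_mean0 => re0 im0.
(* A real-valued integral equal to 0 could come from an infinite extended one; integrability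
   excludes this. *)
have part (u : 'rV[R]_n -> R) :
    (@surface_measure R n).-integrable (@unit_sphere R n) (EFin \o u) ->
    \int[@surface_measure R n]_(th in @unit_sphere R n) u th = 0 ->
    (\int[@surface_measure R n]_(th in @unit_sphere R n) (u th)%:E = 0)%E.
  move=> ui u0; rewrite -[LHS]fineK; first by congr EFin.
  by apply: integrable_fin_num => //; exact: measurable_unit_sphere.
have {}re0 := part _ re_int re0; have {}im0 := part _ im_int im0.
have reh t x : 0 < t -> x != 0 -> ure (t *: x) = ure x.
  by move=> t0 x0; rewrite /ure omega_homogeneous.
have imh t x : 0 < t -> x != 0 -> uim (t *: x) = uim x.
  by move=> t0 x0; rewrite /uim omega_homogeneous.
have ree x : x != 0 -> ure (- x) = ure x by move=> x0; rewrite /ure omega_even.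
have ime x : x != 0 -> uim (- x) = uim x by move=> x0; rewrite /uim omega_even.
have cvg0 x : B x -> cz_truncated K chi_B x @ 0^'+ --> (0 : R[i]).
  rewrite /B /eball/= => Bx.
  have [d1 d1_gt0 re_small] :=
    cz_real_integrand_small n_gt0 reh ree re_int re0 r_gt0 Bx.
  have [d2 d2_gt0 im_small] :=
    cz_real_integrand_small n_gt0 imh ime im_int im0 r_gt0 Bx.
  (* The truncated integrals are exactly 0 once d is below both [d1] and [d2]. *)
  apply: cvg_near_cst; near=> d.
  have d_gt0 : 0 < d by near: d; exact: nbhs_right_gt.
  have dd1 : 0 < d < d1 by rewrite d_gt0/=; near: d; exact: nbhs_right_lt.
  have dd2 : 0 < d < d2 by rewrite d_gt0/=; near: d; exact: nbhs_right_lt.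
  rewrite /cz_truncated /cintegral.
  congr Complex; rewrite /Rintegral.
    under eq_integral do rewrite Re_cz_integrand.
    by rewrite (re_small _ dd1).2.
  under eq_integral do rewrite Im_cz_integrand.
  by rewrite (im_small _ dd2).2.
split=> x.
- move=> Bx; split; last by apply/cvg_ex; exists 0; exact: cvg0.
  move=> d d_gt0; move: Bx; rewrite /B /eball/= => Bx.
  split.
    under eq_fun do rewrite Re_cz_integrand.
    exact: (cz_real_integrand_integrable n_gt0 reh ree re_int re0 r_gt0 Bx d_gt0).
  under eq_fun do rewrite Im_cz_integrand.
  exact: (cz_real_integrand_integrable n_gt0 imh ime im_int im0 r_gt0 Bx d_gt0).
(* Outside B the factor [chi_B x] vanishes, whatever the value of the limit. *)
- have [Bx|nBx] := pselect (B x); last by rewrite /chi_B indicE memNset ?mulr0.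
  by rewrite /cz_operator (cvg_lim _ (cvg0 x Bx)) ?mul0r//; exact: norm_hausdorff.
Unshelve. all: by end_near. Qed.
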